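(* Let $\mathbb{T}$ be any time scale with $\alpha_1\in\mathbb{T}$ and $\sup\mathbb{T}=\infty$. Suppose that $f:[\alpha_1,\infty)_{\mathbb{T}}\to\mathbb{R}$ is a real-valued function satisfying: (i) $f(\alpha_1)=\beta_1$; (ii) $f$ is continuous on $[\alpha_1,\infty)_{\mathbb{T}}$, and right-dense continuous at $\alpha_1$; (iii) $f$ is strictly increasing on $[\alpha_1,\infty)_{\mathbb{T}}$ and such that its image $\widetilde{\mathbb{T}}:=f([\alpha_1,\infty)_{\mathbb{T}})$ is also a time scale. Then for any $a\in[\alpha_1,\infty)_{\mathbb{T}}$ and $b\in[\beta_1,\infty)_{\widetilde{\mathbb{T}}}$ we have $$ ab \le \int_{\alpha_1}^a f(t)\,\Delta t + \int_{\beta_1}^b f^{-1}(y)\,\widetilde{\nabla} y + \alpha_1\beta_1. $$ For fixed $a$, equality holds if and only if $b\in\{f(\rho(a)),f(a)\}$; for fixed $b$, equality holds if and only if $a\in\{f^{-1}(b),\sigma(f^{-1}(b))\}$. The inequality is reversed if $f$ is strictly decreasing (with the other hypotheses unchanged).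
   Context: A time scale is a nonempty closed subset of $\mathbb{R}$; intervals with a subscript denote intersections, e.g. $[\alpha_1,\infty)_{\mathbb{T}}=[\alpha_1,\infty)\cap\mathbb{T}$. The jump operators of $\mathbb{T}$ are $\sigma(t)=\inf\{s\in\mathbb{T}:s>t\}$ and $\rho(t)=\sup\{s\in\mathbb{T}:s<t\}$, with $\sigma(\max\mathbb{T})=\max\mathbb{T}$ and $\rho(\min\mathbb{T})=\min\mathbb{T}$. For $a=\alpha_1$, the set $\{f(\rho(a)),f(a)\}$ is read as $\{f(\alpha_1)\}$. The delta and nabla derivatives are $h^\Delta(t)=\lim_{s\to t}\frac{h(\sigma(t))-h(s)}{\sigma(t)-s}$ and $h^\nabla(t)=\lim_{s\to t}\frac{h(\rho(t))-h(s)}{\rho(t)-s}$. For continuous $h$, $\int_r^s h(t)\,\Delta t=H(s)-H(r)$ where $H^\Delta=h$, and $\int_r^s h(t)\,\nabla t=H(s)-H(r)$ where $H^\nabla=h$; integrals are oriented ($\int_r^s=-\int_s^r$). The symbol $\widetilde{\nabla}$ denotes nabla integration on the time scale $\widetilde{\mathbb{T}}$, and $\Delta$ denotes delta integration on $\mathbb{T}$. *)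

(* Defs.v *)
From HB Require Import structures.
From mathcomp Require Export all_boot all_order all_algebra.
From mathcomp Require Export all_classical all_reals all_analysis.
Set Implicit Arguments.
Unset Strict Implicit.
Unset Printing Implicit Defensive.
Export Order.TTheory GRing.Theory Num.Theory.
Export numFieldNormedType.Exports.
Local Open Scope classical_set_scope.
Local Open Scope ring_scope.

Section time_scales.
Context {R : realType}.
Implicit Types (T : set R) (h : R -> R) (t r s : R).

Definition time_scale T : Prop := closed T /\ T !=set0.

Definition ray T t : set R := T `&` `[t, +oo[%classic.

Definition seg T r s : set R :=
  T `&` `[Num.min r s, Num.max r s]%classic.

Definition sigma T t : R :=
  let above := [set s | T s /\ t < s] in
  if `[< above !=set0 >] then inf above else t.

Definition rho T t : R :=
  let below := [set s | T s /\ s < t] in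
  if `[< below !=set0 >] then sup below else t.

Definition right_dense T t : Prop :=
  (exists2 s, T s & t < s) /\ sigma T t = t.

Definition left_dense T t : Prop :=
  (exists2 s, T s & s < t) /\ rho T t = t.

Definition rd_continuous_at T h t : Prop :=
  (right_dense T t -> h s @[s --> within T (nbhs t)] --> h t) /\
  (left_dense T t -> cvg (h s @[s --> within T t^'-])).

(* The difference quotient only makes sense for s <> sigma T t, so this is
   the only exclusion: s = t is allowed when t is right-scattered (and is what
   produces the forward difference at an isolated point).  At a left-scattered
   maximum of T the limit is over a trivial filter and every l qualifies; this
   plays the role of the usual restriction of t to T minus that point. *)
Definition is_delta_derive T h t (l : R) : Prop :=
  (h (sigma T t) - h s) / (sigma T t - s)
    @[s --> within [set s | T s /\ s <> sigma T t] (nbhs t)] --> l.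

(* Same conventions, with the left-scattered maximum replaced by a
   right-scattered minimum. *)
Definition is_nabla_derive T h t (l : R) : Prop :=
  (h (rho T t) - h s) / (rho T t - s)
    @[s --> within [set s | T s /\ s <> rho T t] (nbhs t)] --> l.

(* The antiderivative is only required to have derivative h at the points of T
   between r and s, so that h need only be meaningful there; the derivative
   itself is taken in the whole time scale T.  No order between r and s is
   assumed: the integral is oriented. *)
Definition is_delta_int T h r s (I : R) : Prop :=
  exists H : R -> R,
    (forall t, seg T r s t -> is_delta_derive T H t (h t)) /\ I = H s - H r.

Definition is_nabla_int T h r s (I : R) : Prop :=
  exists H : R -> R,
    (forall t, seg T r s t -> is_nabla_derive T H t (h t)) /\ I = H s - H r.

Definition delta_int T h r s : R := get [set I | is_delta_int T h r s I].

Definition nabla_int T h r s : R := get [set I | is_nabla_int T h r s I].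

End time_scales.

(* Main.v *)
(* A nondecreasing continuous f has a delta primitive H satisfying
   f(r)(s - r) <= H(s) - H(r) <= f(s)(s - r) for r <= s, with equality on the left
   when [r, s] is a gap of the time scale: integrate the extension of f that is
   constant on the gaps. Integration by parts becomes the remark that
   y = f(t) |-> t f(t) - H(t) is a nabla primitive of the inverse of f, so that for
   b = f(c) the right-hand side of Young's inequality minus a b equals
   H(a) - H(c) - f(c)(a - c). This is nonnegative by the bounds on H and, by strict
   monotonicity, vanishes only for a = c or when c < a are the ends of a gap.
   The integrals are evaluated from these primitives because a function with zero
   delta (or, by reflection, nabla) derivative is constant.
   If f is decreasing, beta1 is the maximum of the image, which forces b = beta1. *)
Require Import Defs.
From mathcomp Require Import lra measurable_realfun.
Set Implicit Arguments.
Unset Strict Implicit.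
Unset Printing Implicit Defensive.
Local Open Scope classical_set_scope.
Local Open Scope ring_scope.

(** * Jump operators of a closed set, and their exchange by reflection *)

Section jumps.
Context {R : realType}.
Implicit Types (T A : set R) (G h : R -> R) (p t r s e : R).

Lemma closed_sup_mem T A :
  closed T -> A `<=` T -> A !=set0 -> has_ubound A -> T (sup A).
Proof.
move=> cT AT A0 uA; rewrite (closure_id T).1//.
exact: (closureS AT) (closure_sup A0 uA).
Qed.

Lemma closedN T : closed T -> closed (-%R @^-1` T).
Proof. by apply: preimage_closed => x _; exact: opp_continuous. Qed.

Lemma closed_inf_mem T A :
  closed T -> A `<=` T -> A !=set0 -> has_lbound A -> T (inf A).
Proof.
move=> cT AT [s As] [l lA]; apply: (closed_sup_mem (closedN cT)).
- by move=> _ [u Au <-] /=; rewrite opprK; exact: AT.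
- by exists (- s), s.
- by exists (- l) => _ [u Au <-]; rewrite lerN2 lA.
Qed.

Lemma sigma_ge T t : t <= sigma T t.
Proof.
rewrite /sigma; case: asboolP => // A0.
by apply: lb_le_inf => // s [_ /ltW].
Qed.

Lemma sigma_le T t s : T s -> t < s -> sigma T t <= s.
Proof.
move=> Ts ts; rewrite /sigma asboolT; last by exists s.
by apply: ge_inf => //; exists t => u [_ /ltW].
Qed.

Lemma sigma_mem T t : closed T -> T t -> T (sigma T t).
Proof.
move=> cT Tt; rewrite /sigma; case: asboolP => // A0.
by apply: closed_inf_mem => // [s []//|]; exists t => s [_ /ltW].
Qed.

Lemma right_dense_approx T t e : right_dense T t -> 0 < e ->
  exists2 s, T s & t < s < t + e.
Proof.
move=> [[s0 Ts0 ts0] ]; rewrite /sigma asboolT; last by exists s0.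
move=> st e0.
have hi : has_inf [set s | T s /\ t < s].
  by split; [exists s0|exists t => u [_ /ltW]].
have [s [Ts ts] se] := inf_adherent e0 hi; exists s => //.
by rewrite ts/=; move: se; rewrite st.
Qed.

(** Reflection in 0 exchanges the two jumps; most facts on [rho] are obtained from facts on [sigma]
    in this way. *)
Lemma rhoE T t : rho T t = - sigma (-%R @^-1` T) (- t).
Proof.
rewrite /rho /sigma.
have -> : [set s | (-%R @^-1` T) s /\ - t < s] = -%R @` [set s | T s /\ s < t].
  apply/seteqP; split => [s [/= Ts ts]|_ [s [/= Ts ts] <-]].
    by exists (- s); rewrite ?opprK// ltrNl.
  by rewrite opprK ltrN2.
have -> : `[< -%R @` [set s | T s /\ s < t] !=set0 >] =
          `[< [set s | T s /\ s < t] !=set0 >].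
  by apply: asbool_equiv_eq; split => [[_ [s As _]]|[s As]]; [exists s|exists (- s), s].
case: ifP; rewrite ?opprK// => _.
by rewrite /inf setNK.
Qed.

Lemma rho_le T t : rho T t <= t.
Proof. by rewrite rhoE lerNl sigma_ge. Qed.

Lemma rho_ge T t s : T s -> s < t -> s <= rho T t.
Proof.
move=> Ts st; rewrite rhoE lerNr sigma_le ?ltrN2//=; by rewrite opprK.
Qed.

Lemma rho_mem T t : closed T -> T t -> T (rho T t).
Proof.
move=> cT Tt; rewrite rhoE; apply: (sigma_mem (closedN cT)) => /=.
by rewrite opprK.
Qed.

Lemma rho_sigma T t s : T t -> T s -> s < t -> t = sigma T s -> rho T t = s.
Proof.
move=> Tt Ts st E; apply/eqP; rewrite eq_le rho_ge// andbT.
rewrite leNgt; apply/negP => sr.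
have: exists2 u, T u & s < u < t.
  have /asboolT nb : [set s | T s /\ s < t] !=set0 by exists s.
  have hs : has_sup [set s | T s /\ s < t].
    by split; [exists s|exists t => u [_ /ltW]].
  have /sup_adherent/(_ hs) [u [Tu ut] ru] : 0 < rho T t - s by rewrite subr_gt0.
  exists u => //; rewrite ut andbT; move: ru.
  by rewrite {1}/rho nb subKr.
move=> [u Tu /andP[su]]; rewrite ltNge => /negP; apply.
by rewrite E sigma_le.
Qed.

Lemma sigma_rho T t s : T t -> T s -> s < t -> s = rho T t -> sigma T s = t.
Proof.
move=> Tt Ts st E.
have := @rho_sigma (-%R @^-1` T) (- s) (- t).
rewrite rhoE /= !opprK => /(_ Ts Tt); rewrite ltrN2 => /(_ st) H.
have NN : -%R @^-1` (-%R @^-1` T) = T.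
  by apply/funext => x /=; rewrite opprK.
rewrite NN in H; apply: oppr_inj; apply: H.
by rewrite E rhoE opprK.
Qed.

End jumps.

(** * Derivatives in increment form, and evaluation of integrals from primitives *)

Section derivatives.
Context {R : realType}.
Implicit Types (T : set R) (G h H : R -> R) (p t l r s e : R).

(* The increment form of a derivative with jump point [p]: being trivially true
   at [s = p], it needs no exclusion. *)
Definition jump_derive T h p t l : Prop :=
  forall e, 0 < e -> exists2 d, 0 < d &
    forall s, T s -> `|s - t| < d -> `|h p - h s - l * (p - s)| <= e * `|p - s|.

Lemma jump_deriveP T h p t l :
  (h p - h s) / (p - s) @[s --> within [set s | T s /\ s <> p] (nbhs t)] --> l
  <-> jump_derive T h p t l.
Proof.
have E s : s <> p -> `|l - (h p - h s) / (p - s)| * `|p - s| =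
                     `|h p - h s - l * (p - s)|.
  move=> sp; have ps : p - s != 0 by rewrite subr_eq0; apply/eqP => /esym.
  by rewrite -normrM mulrBl mulfVK// distrC.
rewrite cvgrPdist_le; split => [H e /H|H e /H [d d0 Hd]].
  move=> /nbhs_ballP[d /= d0 Hd]; exists d => // s Ts sd.
  have [->|/eqP sp] := eqVneq s p; first by rewrite !subrr mulr0 subrr normr0 mulr0.
  by rewrite -E// ler_wpM2r//; apply: Hd => //; rewrite /ball/= distrC.
apply/nbhs_ballP; exists d => //= s; rewrite /ball/= distrC => sd [Ts sp].
have ps : 0 < `|p - s| by rewrite normr_gt0 subr_eq0; apply/eqP => /esym.
by rewrite -(ler_pM2r ps) E// Hd.
Qed.

Lemma jump_deriveB T G h p t l l' : jump_derive T G p t l ->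
  jump_derive T h p t l' -> jump_derive T (G \- h) p t (l - l').
Proof.
move=> HG Hh e e0.
have e2 : 0 < e / 2 by rewrite divr_gt0.
have [d1 d10 H1] := HG _ e2; have [d2 d20 H2] := Hh _ e2.
exists (Num.min d1 d2); first by rewrite lt_min d10.
move=> s Ts; rewrite lt_min => /andP[/(H1 _ Ts) h1 /(H2 _ Ts) h2] /=.
have -> : G p - h p - (G s - h s) - (l - l') * (p - s) =
  (G p - G s - l * (p - s)) - (h p - h s - l' * (p - s)) by lra.
apply: (le_trans (ler_normB _ _)); lra.
Qed.

Lemma jump_deriveN T h p t l : jump_derive T h p t l ->
  jump_derive (-%R @^-1` T) (h \o -%R) (- p) (- t) (- l).
Proof.
move=> H e /H [d d0 Hd]; exists d => // s /= Ts sd.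
have := Hd _ Ts; rewrite -normrN opprB opprK addrC => /(_ _)/=.
move: sd; rewrite !opprK -[- p - s]opprD normrN mulrNN addrC => sd; exact.
Qed.

Lemma ler_divM e z w : 0 <= e -> 0 < w -> z <= w -> e / w * z <= e.
Proof. by move=> e0 w0 zw; rewrite mulrAC ler_pdivrMr// ler_wpM2l. Qed.

(** Induction along the time scale: for each [e > 0] the bound [|G u - G r| <= e * (u - r)] holds up
    to a supremum [c], which is attained, and it could be pushed beyond [c] if [c < s]. As [e] is
    arbitrary, equality follows. *)
Lemma zero_delta_const T G r s : closed T -> T r -> T s -> r <= s ->
  (forall t, T t -> r <= t <= s -> jump_derive T G (sigma T t) t 0) -> G s = G r.
Proof.
move=> cT Tr Ts rs HG.
have {}HG t : T t -> r <= t <= s -> forall e, 0 < e -> exists2 d, 0 < d &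
    forall u, T u -> `|u - t| < d -> `|G (sigma T t) - G u| <= e * `|sigma T t - u|.
  move=> Tt rts e /(HG _ Tt rts)[d d0 Hd]; exists d => // u Tu /(Hd _ Tu).
  by rewrite mul0r subr0.
have small (x y : R) : 0 <= y -> (forall e, 0 < e -> `|x| <= e * y) -> x = 0.
  move=> y0 H; apply: normr0_eq0; apply/eqP; rewrite eq_le normr_ge0 andbT.
  apply/ler_addgt0Pr => e e0; rewrite add0r.
  have y1 : 0 < y + 1 by lra.
  apply: (le_trans (H (e / (y + 1)) (divr_gt0 e0 y1))).
  by apply: ler_divM; lra.
apply/eqP; rewrite -subr_eq0; apply/eqP/(small _ (s - r)); first by rewrite subr_ge0.
move=> e e0.
pose A := [set t | [/\ T t, r <= t <= s &
  forall u, T u -> r <= u <= t -> `|G u - G r| <= e * (u - r)]].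
have Ar : A r.
  split => //; first by rewrite lexx.
  by move=> u _; rewrite -eq_le => /eqP <-; rewrite !subrr normr0 mulr0.
have A0 : A !=set0 by exists r.
have uA : ubound A s by move=> t [_ /andP[]].
have hA : has_sup A by split => //; exists s.
pose c := sup A.
have Tc : T c by apply: closed_sup_mem => //; [move=> t []|exists s].
have rc : r <= c by apply: ub_le_sup => //; exists s.
have cs : c <= s by apply: ge_sup.
have rcs : r <= c <= s by rewrite rc.
(* Testing the derivative at [u = c] itself shows that [G] does not change across the jump. *)
have Gsc : G (sigma T c) = G c.
  apply/eqP; rewrite -subr_eq0; apply/eqP/(small _ `|sigma T c - c|) => // e' e'0.
  by have [d d0 Hd] := HG _ Tc rcs _ e'0; apply: Hd; rewrite // subrr normr0.
have Ac : A c.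
  have below u : T u -> r <= u -> u < c -> `|G u - G r| <= e * (u - r).
    move=> Tu ru uc; have /sup_adherent/(_ hA)[t [Tt rts Ht]] : 0 < c - u by rewrite subr_gt0.
    by rewrite subKr => ut; apply: Ht => //; rewrite ru ltW.
  split => // u Tu /andP[ru]; rewrite le_eqVlt => /predU1P[->{u Tu ru}|]; last exact: below.
  apply/ler_addgt0Pr => e2 e20.
  have sc := sigma_ge T c.
  (* For [t] less than 1 below [c], [sigma T c - t] is at most this constant; dividing [e2] by it
     yields [|G c - G t| <= e2]. *)
  have y1 : 0 < sigma T c - c + 1 by lra.
  have [d d0 Hd] := HG _ Tc rcs _ (divr_gt0 e20 y1).
  have d10 : 0 < Num.min d 1 by rewrite lt_min d0 ltr01.
  have [t At tc] := sup_adherent d10 hA.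
  have tlec : t <= c by apply: ub_le_sup => //; exists s.
  have [Tt /andP[rt ts] Ht] := At.
  have [dt t1] : c - t < d /\ c - t < 1.
    by apply/andP; rewrite -lt_min ltrBlDr addrC -ltrBlDr.
  have h1 : `|G c - G t| <= e2.
    have := Hd t Tt; rewrite Gsc ler0_norm ?opprB; last by lra.
    move=> /(_ dt) /le_trans; apply.
    rewrite ger0_norm; last by lra.
    by apply: ler_divM; lra.
  have h2 : `|G t - G r| <= e * (t - r) by apply: Ht => //; rewrite rt lexx.
  have h3 : e * (t - r) <= e * (c - r) by rewrite ler_pM2l//; lra.
  have := ler_normD (G c - G t) (G t - G r); rewrite addrA subrK; lra.
have [cs'|] := ltP c s; last first.
  move=> sc; have -> : s = c by apply/eqP; rewrite eq_le sc cs.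
  by case: Ac => _ _; apply => //; rewrite rc lexx.
have [_ _ Hc] := Ac.
have notin v : c < v -> ~ A v.
  by move=> + Av; rewrite ltNge => /negP; apply; apply: ub_le_sup => //; exists s.
(* A larger element of [A] is produced: [sigma T c] if [c] is right-scattered, a nearby point [v] if
   it is right-dense. *)
have [sc|sc] := eqVneq (sigma T c) c; last first.
  have {}sc : c < sigma T c by rewrite lt_neqAle eq_sym sc sigma_ge.
  exfalso; apply: (notin _ sc); split; first exact: sigma_mem.
    by rewrite sigma_le// andbT (le_trans rc)// ltW.
  move=> u Tu /andP[ru us]; have [uc|cu] := leP u c; first by apply: Hc => //; rewrite ru.
  have -> : u = sigma T c by apply/eqP; rewrite eq_le us sigma_le.
  rewrite Gsc; apply: (le_trans (Hc c Tc _)); first by rewrite rc lexx.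
  by rewrite ler_pM2l//; lra.
have rdc : right_dense T c by split => //; exists s.
have [d d0 Hd] := HG _ Tc rcs _ e0.
have [|v Tv /andP[cv]] := @right_dense_approx _ _ _ (Num.min d (s - c)) rdc.
  by rewrite lt_min d0 subr_gt0.
rewrite -ltrBlDl lt_min => /andP[vd vs].
exfalso; apply: (notin _ cv); split => //.
  by apply/andP; split; lra.
move=> u Tu /andP[ru uv]; have [uc|cu] := leP u c; first by apply: Hc => //; rewrite ru.
have h1 : `|G u - G c| <= e * (u - c).
  have := Hd u Tu; rewrite sc (gtr0_norm (_ : 0 < u - c)) ?subr_gt0// => /(_ _).
  rewrite [`|c - u|]distrC [`|G c - _|]distrC (gtr0_norm (_ : 0 < u - c)) ?subr_gt0//.
  by apply; lra.
have h2 : `|G c - G r| <= e * (c - r) by apply: Hc => //; rewrite rc lexx.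
have := ler_normD (G u - G c) (G c - G r); rewrite addrA subrK => /le_trans; apply.
apply: (le_trans (lerD h1 h2)); lra.
Qed.

Lemma zero_nabla_const T G r s : closed T -> T r -> T s -> r <= s ->
  (forall t, T t -> r <= t <= s -> jump_derive T G (rho T t) t 0) -> G s = G r.
Proof.
move=> cT Tr Ts rs HG.
have := @zero_delta_const (-%R @^-1` T) (G \o -%R) (- s) (- r) (closedN cT).
rewrite /= !opprK => -> //; first by rewrite lerN2.
move=> t Tt; rewrite lerNl lerNr => /andP[ts rt].
have -> : sigma (-%R @^-1` T) t = - rho T (- t) by rewrite rhoE !opprK.
rewrite -[t in jump_derive _ _ _ t]opprK -oppr0; apply: jump_deriveN.
by apply: HG => //; rewrite rt ts.
Qed.

Lemma seg_le T r s t : r <= s -> seg T r s t = (T t /\ r <= t <= s).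
Proof.
by move=> rs; rewrite /seg/= min_l// max_r// /setI/= in_itv/=.
Qed.

(** The value chosen by [get] comes from some unknown primitive [H']; since [H' - H] has zero
    derivative, both have the same increment. *)
Lemma delta_int_eq T h H r s : closed T -> T r -> T s -> r <= s ->
  (forall t, T t -> r <= t <= s -> jump_derive T H (sigma T t) t (h t)) ->
  delta_int T h r s = H s - H r.
Proof.
move=> cT Tr Ts rs HH.
have : is_delta_int T h r s (delta_int T h r s).
  apply: getPex; exists (H s - H r), H; split => // t.
  by rewrite seg_le// => -[Tt rts]; apply/jump_deriveP/HH.
move=> [H' [HH' ->]].
suff : (H' \- H) s = (H' \- H) r by rewrite /=; lra.
apply: zero_delta_const cT _ _ _ _ => // t Tt rts.
rewrite -(subrr (h t)); apply: jump_deriveB; last exact: HH.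
by apply/jump_deriveP/HH'; rewrite seg_le.
Qed.

Lemma nabla_int_eq T h H r s : closed T -> T r -> T s -> r <= s ->
  (forall t, T t -> r <= t <= s -> jump_derive T H (rho T t) t (h t)) ->
  nabla_int T h r s = H s - H r.
Proof.
move=> cT Tr Ts rs HH.
have : is_nabla_int T h r s (nabla_int T h r s).
  apply: getPex; exists (H s - H r), H; split => // t.
  by rewrite seg_le// => -[Tt rts]; apply/jump_deriveP/HH.
move=> [H' [HH' ->]].
suff : (H' \- H) s = (H' \- H) r by rewrite /=; lra.
apply: zero_nabla_const cT _ _ _ _ => // t Tt rts.
rewrite -(subrr (h t)); apply: jump_deriveB; last exact: HH.
by apply/jump_deriveP/HH'; rewrite seg_le.
Qed.

End derivatives.

(** * A primitive by Lebesgue integration of a monotone extension *)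

Section step_integral.
Context {R : realType}.
Implicit Types (D : set R) (f F H : R -> R) (r s t u a b : R).
Local Notation mu := (@lebesgue_measure R).

Lemma nondecreasing_integrable F a b : nondecreasing_fun F ->
  mu.-integrable `[a, b[ (EFin \o F).
Proof.
move=> ndF; apply: measurable_bounded_integrable => //.
- rewrite /= lebesgue_measure_itv/=; case: ifP => _; rewrite ?ltry// -EFinB ltry.
- exact: nondecreasing_measurable.
- exists (`|F a| + `|F b|); split; first exact: num_real.
  move=> M /ltW M0 x /=; rewrite in_itv/= => /andP[ax xb].
  apply: le_trans M0; rewrite ler_norml.
  have := ndF _ _ ax; have := ndF _ _ (ltW xb).
  have := ler_norm (F b); have := ler_norm (- F a); rewrite normrN.
  have := normr_ge0 (F a); have := normr_ge0 (F b).
  by move=> *; apply/andP; split; lra.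
Qed.

Lemma Rintegral_nondecreasing_bounds F a b l u : nondecreasing_fun F -> a <= b ->
  (forall x, a <= x < b -> l <= F x <= u) ->
  l * (b - a) <= \int[mu]_(x in `[a, b[) F x <= u * (b - a).
Proof.
move=> ndF ab lFu.
have cstE c : \int[mu]_(x in `[a, b[) c = c * (b - a).
  rewrite Rintegral_cst//= lebesgue_measure_itv/= lte_fin.
  by have [//|ba] := ltP a b; have -> : b = a by [apply/eqP; rewrite eq_le ab ba]; rewrite subrr.
have icst c : mu.-integrable `[a, b[ (EFin \o fun=> c).
  by apply: nondecreasing_integrable.
rewrite -!cstE; apply/andP; split; apply: le_Rintegral => //;
  by [exact: nondecreasing_integrable|move=> x /=; rewrite in_itv/= => /lFu/andP[]].
Qed.

(** A derivative-free form of convexity of [H] with slope [f]; the second clause fixes the increment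
    over a gap. The nabla primitive and the equality cases use only these properties of [H]. *)
Definition monotone_primitive D f H : Prop :=
  (forall r s, D r -> D s -> r <= s -> f r * (s - r) <= H s - H r <= f s * (s - r)) /\
  (forall r s, D r -> D s -> r < s -> (forall u, D u -> r < u -> s <= u) ->
     H s - H r = f r * (s - r)).

(* [F] is the extension of [f] that is constant on the gaps of [D]; half-open
   intervals make its integral over a gap exactly the forward rectangle. *)
Lemma nondecreasing_step_primitive D f a : closed D -> D a ->
  (forall t, D t -> a <= t) -> {in D &, {homo f : x y / x <= y}} ->
  exists H, monotone_primitive D f H.
Proof.
move=> cD Da aD ndf.
(* The maximum with [a] keeps [A x] nonempty for every real [x]; its supremum [M x] is the last
   point of [D] up to [x], or [a] when [x < a]. *)
pose A x := [set t | D t /\ t <= Num.max a x].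
have Aa x : A x a by split => //; rewrite le_max lexx.
have A0 x : A x !=set0 by exists a.
have uA x : has_ubound (A x) by exists (Num.max a x) => t [].
pose M x := sup (A x).
have DM x : D (M x) by apply: closed_sup_mem => // t [].
have leM x t : D t -> t <= x -> t <= M x.
  by move=> Dt tx; apply: ub_le_sup => //; split => //; rewrite le_max tx orbT.
have Mle x t : a <= x -> (forall u, D u -> u <= x -> u <= t) -> M x <= t.
  by move=> ax xt; apply: ge_sup => // u [Du]; rewrite max_r//; exact: xt.
have ndM : nondecreasing_fun M.
  move=> x y xy; apply: ge_sup => // t [Dt tx]; apply: ub_le_sup => //.
  by split => //; rewrite (le_trans tx)// ge_max !le_max lexx xy orbT.
have Mid t : D t -> M t = t.
  by move=> Dt; apply/eqP; rewrite eq_le leM// andbT; apply: Mle => //; exact: aD.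
pose F := f \o M.
have ndF : nondecreasing_fun F.
  by move=> x y xy; apply: ndf; rewrite ?inE//; exact: ndM.
have FE t : D t -> F t = f t by move=> Dt; rewrite /F/= Mid.
exists (fun x => \int[mu]_(u in `[a, x[) F u).
have HB r s : D r -> r <= s ->
    \int[mu]_(u in `[a, s[) F u - \int[mu]_(u in `[a, r[) F u = \int[mu]_(u in `[r, s[) F u.
  move=> Dr rs; have E : [set` `[a, s[] = `[a, r[%classic `|` `[r, s[%classic.
    by apply: itv_bndbnd_setU; rewrite bnd_simp//; exact: aD.
  rewrite E Rintegral_setU//; first by rewrite addrAC subrr add0r.
    by rewrite -E; exact: nondecreasing_integrable.
  apply/disj_setPS => x [/=]; rewrite !in_itv/= => /andP[_ xr] /andP[].
  by rewrite leNgt xr.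
split => [r s Dr Ds rs|r s Dr Ds rs gap].
  rewrite HB//; apply: Rintegral_nondecreasing_bounds => // x /andP[rx xs].
  by rewrite -FE// -(FE s)// !ndF// ltW.
(* On a gap [M] stays at [r], so [F] is constant there and the lower and upper bounds coincide. *)
rewrite HB ?ltW//; apply/eqP; rewrite eq_le andbC.
apply: Rintegral_nondecreasing_bounds => //; first exact: ltW.
move=> x /andP[rx xs]; have -> : F x = f r; last by rewrite lexx.
congr f; apply/eqP; rewrite eq_le leM// andbT; apply: Mle => [|u Du ux].
  by rewrite (le_trans (aD _ Dr)).
by rewrite leNgt; apply/negP => /(gap _ Du); rewrite leNgt (le_lt_trans ux).
Qed.
End step_integral.

(** * Delta primitives, nabla primitives of the inverse, and the equality cases *)

Section monotone_primitives.
Context {R : realType}.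
Implicit Types (T D : set R) (f H : R -> R) (a b c d r s t u e : R).

Lemma closed_ray T a : closed T -> closed (ray T a).
Proof. by move=> cT; apply: closedI => //; exact: interval_closed. Qed.

Lemma rayP T a t : ray T a t <-> T t /\ a <= t.
Proof. by rewrite /ray /setI/= in_itv/= andbT. Qed.

Lemma within_continuous_dist D f t e : {within D, continuous f} -> D t -> 0 < e ->
  exists2 d, 0 < d & forall s, D s -> `|s - t| < d -> `|f s - f t| <= e.
Proof.
move=> /subspace_continuousP/(_ t) fc /fc /cvgrPdist_le H e0.
have /nbhs_ballP[d /= d0 Hd] := H _ e0; exists d => // s Ds sd.
by rewrite distrC; apply: Hd => //; rewrite /ball/= distrC.
Qed.

(** Supplies one radius for scattered and dense points alike: nothing closer than [d] to one end of
    a genuine gap lies across it. *)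
Lemma gap_dist (x y : R) : x <= y ->
  exists2 d, 0 < d & x < y -> d <= y - x.
Proof.
rewrite le_eqVlt => /predU1P[->|xy]; first by exists 1; rewrite ?ltr01// ltxx.
by exists (y - x); rewrite ?subr_gt0.
Qed.

Lemma delta_primitive_exists T a f : closed T -> T a ->
  {within ray T a, continuous f} ->
  {in ray T a &, {homo f : x y / x <= y}} ->
  exists H, monotone_primitive (ray T a) f H /\
    forall t, ray T a t -> jump_derive T H (sigma T t) t (f t).
Proof.
move=> cT Ta fc ndf; set D := ray T a.
have Da : D a by apply/rayP.
have aD t : D t -> a <= t by move=> /rayP[].
have [H [HB HG]] := nondecreasing_step_primitive (closed_ray (a := a) cT) Da aD ndf.
(* The derivative is taken in all of [T], which may accumulate at [a] from the left; continuing [H]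
   below [a] with slope [f a] keeps the derivative there equal to [f a]. *)
pose H' s := if s < a then H a + f a * (s - a) else H s.
have H'E s : D s -> H' s = H s by move=> /aD; rewrite /H' ltNge => ->.
exists H'; split.
  split => [r s Dr Ds|r s Dr Ds]; rewrite !H'E//; [exact: HB|exact: HG].
move=> t Dt e e0; have [Tt at_] := (rayP _ _ _).1 Dt.
have tp := sigma_ge T t; set p := sigma T t in tp *.
have Dp : D p by apply/rayP; split; [exact: sigma_mem|exact: le_trans tp].
have HpE : H p - H t = f t * (p - t).
  have [tp'|pt] := ltP t p; last first.
    by have -> : p = t by [apply/eqP; rewrite eq_le pt]; rewrite !subrr mulr0.
  by apply: HG => // u /rayP[Tu _]; exact: sigma_le.
have [d1 d10 Hd1] := within_continuous_dist fc Dt e0.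
have [d2 d20 Hd2] := gap_dist tp.
have [d3 d30 Hd3] := gap_dist at_.
exists (Num.min d1 (Num.min d2 d3)); first by rewrite !lt_min d10 d20.
move=> s Ts; rewrite !lt_min => /and3P[sd1 sd2 sd3].
(* By the choice of [d3], a point below [a] is this close to [t] only if [t = a], where the
   increment is exact. *)
have [sa|as_] := ltP s a.
  have ta : t = a.
    apply/eqP; rewrite eq_le at_ andbT leNgt; apply/negP => /Hd3.
    by move: sd3; rewrite ltr_norml => /andP[]; lra.
  rewrite H'E// /H' sa -ta; have -> : H p - (H t + f t * (s - t)) - f t * (p - s) = 0 by lra.
  by rewrite normr0 mulr_ge0// ltW.
have Ds : D s by apply/rayP.
(* [HpE] moves the base point from the jump [p] to [t]; the bounds on [H] then leave at most
   [|f t - f s| * |t - s|]. *)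
rewrite !H'E//; have -> : H p - H s - f t * (p - s) = H t - H s - f t * (t - s) by lra.
have := Hd1 _ Ds sd1; rewrite ler_norml => /andP[fd1 fd2].
have [st|ts] := leP s t.
  have /andP[B1 B2] := HB _ _ Ds Dt st.
  have h1 : e * (t - s) <= e * `|p - s|.
    by rewrite ler_pM2l// (le_trans _ (ler_norm _))//; lra.
  have h2 : (f t - f s) * (t - s) <= e * (t - s) by apply: ler_wpM2r; lra.
  by apply: le_trans h1; rewrite ler_norml; apply/andP; split; lra.
(* A point [s > t] within [d2] of [t] rules out a gap to the right of [t]. *)
have pt : p = t.
  apply/eqP; rewrite eq_le tp andbT leNgt; apply/negP => tp'.
  have := Hd2 tp'; have := sigma_le Ts ts; rewrite -/p.
  by move: sd2; rewrite ltr_norml => /andP[]; lra.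
have /andP[B1 B2] := HB _ _ Dt Ds (ltW ts).
rewrite pt distrC; have -> : `|t - s| = s - t by rewrite distrC gtr0_norm ?subr_gt0.
have h2 : (f s - f t) * (s - t) <= e * (s - t) by apply: ler_wpM2r; lra.
by rewrite ler_norml; apply/andP; split; lra.
Qed.

(* The inverse of [f] is continuous at [f t] because the closed set [D] has, on
   each side, a nearest point among those at distance at least [e] from [t]. *)
Lemma increasing_inverse_dist D f t e : closed D -> D t ->
  {in D &, {homo f : x y / x < y}} -> 0 < e ->
  exists2 d, 0 < d & forall s, D s -> `|f s - f t| < d -> `|s - t| <= e.
Proof.
move=> cD Dt incf e0.
have lef x y : D x -> D y -> x <= y -> f x <= f y.
  by move=> Dx Dy; apply: (ltW_homo_in incf); rewrite inE.
have [dl dl0 Hl] : exists2 d, 0 < d & forall s, D s -> s < t - e -> d <= f t - f s.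
  have [[s0 [Ds0 s0t]]|none] := pselect (exists s, D s /\ s <= t - e); last first.
    by exists 1 => // s Ds /ltW st; case: none; exists s.
  pose A := [set s | D s /\ s <= t - e].
  have uA : has_ubound A by exists (t - e) => s [].
  have Ds1 : D (sup A) by apply: closed_sup_mem => //; [move=> s []|exists s0].
  have s1t : sup A <= t - e by apply: ge_sup => [|s []//]; exists s0.
  exists (f t - f (sup A)); first by rewrite subr_gt0 incf ?inE//; lra.
  by move=> s Ds /ltW st; rewrite lerD2l lerN2 lef//; apply: ub_le_sup.
have [dr dr0 Hr] : exists2 d, 0 < d & forall s, D s -> t + e < s -> d <= f s - f t.
  have [[s0 [Ds0 s0t]]|none] := pselect (exists s, D s /\ t + e <= s); last first.
    by exists 1 => // s Ds /ltW st; case: none; exists s.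
  pose A := [set s | D s /\ t + e <= s].
  have lA : has_lbound A by exists (t + e) => s [].
  have Ds1 : D (inf A) by apply: closed_inf_mem => //; [move=> s []|exists s0].
  have s1t : t + e <= inf A by apply: lb_le_inf => [|s []//]; exists s0.
  exists (f (inf A) - f t); first by rewrite subr_gt0 incf ?inE//; lra.
  by move=> s Ds /ltW st; rewrite lerD2r lef//; apply: ge_inf.
exists (Num.min dl dr); first by rewrite lt_min dl0.
move=> s Ds; rewrite lt_min !ltr_norml => /andP[/andP[h1 h2] /andP[h3 h4]].
rewrite ler_norml lerBrDr lerBlDr; apply/andP; split; rewrite leNgt; apply/negP => h.
  by have := Hl s Ds; rewrite addrC => /(_ h); lra.
by have := Hr s Ds; rewrite addrC => /(_ h); lra.
Qed.

(* Integration by parts: with [H' = f], the function [t f(t) - H t] of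
   [y = f(t)] is a nabla primitive of the inverse of [f]. *)
Lemma nabla_primitive_inverse D f H t : closed D -> closed (f @` D) ->
  {in D &, {homo f : x y / x < y}} -> monotone_primitive D f H -> D t ->
  jump_derive (f @` D) (fun y => y * pinv D f y - H (pinv D f y))
    (rho (f @` D) (f t)) (f t) (pinv D f (f t)).
Proof.
move=> cD cTt incf [HB HG] Dt e e0; set Tt := f @` D.
have incf' x y : D x -> D y -> (f x < f y) = (x < y).
  by move=> Dx Dy; apply: (leW_mono_in (le_mono_in incf)); rewrite inE.
have injf : {in D &, injective f} := inc_inj_in (le_mono_in incf).
have fK s : D s -> pinv D f (f s) = s by move=> Ds; apply: pinvKV; rewrite ?inE.
(* The backward jump in the image is read back in [D] as [q]: no point of [D] lies strictly between
   [q] and [t]. *)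
have [q Dq fq] : Tt (rho Tt (f t)) by apply: rho_mem => //; exists t.
have qt : q <= t by rewrite leNgt -incf'// fq -leNgt rho_le.
have gap s : D s -> s < t -> s <= q.
  by move=> Ds st; rewrite leNgt -incf'// fq -leNgt rho_ge ?incf'//; exists s.
have HqE : H t - H q = f q * (t - q).
  have [qt'|tq] := ltP q t; last first.
    by have -> : q = t by [apply/eqP; rewrite eq_le qt]; rewrite !subrr mulr0.
  by apply: HG => // u Du; apply: contraTT; rewrite -!ltNge -leNgt; exact: gap.
have fqt : f q <= f t by rewrite fq rho_le.
have [d1 d10 Hd1] := increasing_inverse_dist cD Dt incf e0.
have [d2 d20 Hd2] := gap_dist fqt.
exists (Num.min d1 d2); first by rewrite lt_min d10.
move=> _ [s Ds <-]; rewrite lt_min => /andP[sd1 sd2].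
rewrite -fq !fK//.
(* By [HqE] the terms in [q] cancel. The bounds on [H] leave at most [|s - t| * |f s - f t|], and
   [|s - t| <= e] by continuity of the inverse. *)
have -> : f q * q - H q - (f s * s - H s) - t * (f q - f s) =
          H s - H t + f s * (t - s) by lra.
have := Hd1 _ Ds sd1; rewrite ler_norml => /andP[sd3 sd4].
have [st|ts|->] := ltgtP s t; last first.
- by rewrite !subrr mulr0 addr0 normr0 mulr_ge0// ltW.
- have /andP[B1 B2] := HB _ _ Dt Ds (ltW ts).
  have fts : f t < f s by rewrite incf'.
  have h1 : e * (f s - f t) <= e * `|f q - f s|.
    by rewrite ler_pM2l// distrC (le_trans _ (ler_norm _))//; lra.
  have h2 : (s - t) * (f s - f t) <= e * (f s - f t) by apply: ler_wpM2r; lra.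
  by apply: le_trans h1; rewrite ler_norml; apply/andP; split; lra.
- have /andP[B1 B2] := HB _ _ Ds Dt (ltW st).
  have fst : f s < f t by rewrite incf'.
  have fsq : f s <= f q by rewrite fq rho_ge//; exists s.
  have E : f q = f t.
    apply/eqP; rewrite eq_le fqt leNgt; apply/negP => /Hd2.
    by move: sd2; rewrite ltr_norml => /andP[]; lra.
  have h1 : e * (f t - f s) <= e * `|f q - f s|.
    by rewrite E ler_pM2l// ler_norm.
  have h2 : (t - s) * (f t - f s) <= e * (f t - f s) by apply: ler_wpM2r; lra.
  by apply: le_trans h1; rewrite ler_norml; apply/andP; split; lra.
Qed.

(** [f c] is the slope of a supporting line of [H] at [c], as for a convex function. *)
Lemma monotone_primitive_remainder_ge0 D f H a c : monotone_primitive D f H ->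
  D a -> D c -> f c * (a - c) <= H a - H c.
Proof.
move=> [HB _] Da Dc; have [ca|/ltW ac] := leP c a.
  by have /andP[] := HB _ _ Dc Da ca.
by have /andP[] := HB _ _ Da Dc ac; lra.
Qed.

(** A point [d] of the ray strictly between [a] and [c] splits the remainder into the one from [c]
    to [d], the one from [d] to [a], and [(f d - f c) * (a - d) > 0]. Equality therefore leaves no
    such point. *)
Lemma monotone_primitive_remainder_eq0 T o f H a c : closed T ->
  {in ray T o &, {homo f : x y / x < y}} -> monotone_primitive (ray T o) f H ->
  ray T o a -> ray T o c ->
  H a - H c = f c * (a - c) <-> a = c \/ a = sigma T c.
Proof.
set D := ray T o => cT incf HP Da Dc; have [HB HG] := HP.
have lt_f x y : D x -> D y -> x < y -> f x < f y by move=> Dx Dy; apply: incf; rewrite inE.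
have [Ta oa] := (rayP _ _ _).1 Da; have [Tc oc] := (rayP _ _ _).1 Dc.
split=> [E|[->|ac]]; last 2 first.
- by rewrite !subrr mulr0.
- have := sigma_ge T c; rewrite -ac le_eqVlt => /predU1P[->|ca].
    by rewrite !subrr mulr0.
  by apply: HG => // u /rayP[Tu _] cu; rewrite ac sigma_le.
have noD d : D d -> c < d < a \/ a < d < c -> False.
  move=> Dd; have h1 := monotone_primitive_remainder_ge0 HP Dd Dc.
  have h2 := monotone_primitive_remainder_ge0 HP Da Dd.
  have h3 : 0 <= (f d - f c) * (a - d) -> H a - H c = f c * (a - c) ->
            (f d - f c) * (a - d) = 0 by lra.
  move=> [/andP[cd da]|/andP[ad dc]].
    have := lt_f _ _ Dc Dd cd; rewrite -subr_gt0 => p1.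
    have p2 : 0 < a - d by rewrite subr_gt0.
    by have := mulr_gt0 p1 p2; move=> p3; have := h3 (ltW p3) E; lra.
  have := lt_f _ _ Dd Dc dc; rewrite -subr_lt0 => p1.
  have p2 : a - d < 0 by rewrite subr_lt0.
  by have := nmulr_rgt0 (a - d) p1; rewrite p2 => p3; have := h3 (ltW p3) E; lra.
have [ac|ca|->] := ltgtP a c; last by left.
(* If [a < c] were the ends of a gap, its increment [f a * (c - a)] would force [f a = f c]. *)
- have := HG _ _ Da Dc ac; move=> /(_ _) h.
  have := lt_f _ _ Da Dc ac; rewrite -subr_gt0 => p1.
  have p2 : 0 < c - a by rewrite subr_gt0.
  have p3 := mulr_gt0 p1 p2.
  have : H c - H a = f a * (c - a); last by lra.
  apply: h => u Du au; rewrite leNgt; apply/negP => uc.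
  by apply: (noD u) => //; right; rewrite au.
- right; apply/eqP; rewrite eq_le sigma_le// andbT leNgt; apply/negP => sa.
  have Dsc : D (sigma T c).
    by apply/rayP; split; [exact: sigma_mem|apply: le_trans oc (sigma_ge T c)].
  have := sigma_ge T c; rewrite le_eqVlt => /predU1P[cs|cs]; last first.
    by apply: (noD _ Dsc); left; rewrite cs.
  have rdc : right_dense T c by split => //; exists a.
  have [|v Tv /andP[cv va]] := @right_dense_approx _ _ _ (a - c) rdc.
    by rewrite subr_gt0.
  apply: (noD v); first by apply/rayP; split => //; rewrite (le_trans oc)// ltW.
  by left; rewrite cv; move: va; rewrite addrC subrK.
Qed.

(** The case [a = o] is separate because [rho T o] may be a point of [T] below [o], outside the
    ray. *)
Lemma eq_sigma_rho T o a c : closed T -> ray T o a -> ray T o c ->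
  (a = c \/ a = sigma T c) <-> (if a == o then c = o else c = rho T a \/ c = a).
Proof.
move=> cT /rayP[Ta oa] /rayP[Tc oc]; have sc := sigma_ge T c; have ra := rho_le T a.
have [ao|ao] := eqVneq a o.
  split=> [|->]; last by left.
  by move=> [ac|ac]; apply/eqP; rewrite eq_le oc andbT -ao ac.
split=> [[->|as_]|[cr|->]]; [by right| |  |by left].
- have := sc; rewrite -as_ le_eqVlt => /predU1P[->|ca]; first by right.
  by left; rewrite (rho_sigma Ta Tc).
- have := ra; rewrite -cr le_eqVlt => /predU1P[->|ca]; first by left.
  by right; rewrite (sigma_rho Ta Tc).
Qed.

End monotone_primitives.

(** * Young's inequality on a time scale and its image *)

Theorem theorem2p1 (R : realType) (T : set R) (alpha1 beta1 : R) (f : R -> R)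
    (T_ts : time_scale T) (T_alpha1 : T alpha1)
    (sup_T : ereal_sup [set x%:E | x in T] = +oo%E)
    (f_alpha1 : f alpha1 = beta1)
    (f_cont : {within ray T alpha1, continuous f})
    (f_rd : rd_continuous_at (ray T alpha1) f alpha1)
    (image_ts : time_scale (f @` ray T alpha1)) :
  let D := ray T alpha1 in
  let Tt := f @` D in
  let young a b := delta_int T f alpha1 a
                   + nabla_int Tt (pinv D f) beta1 b + alpha1 * beta1 in
  ({in D &, {homo f : x y / x < y}} ->
    forall a b, D a -> ray Tt beta1 b ->
      [/\ a * b <= young a b,
          a * b = young a b <->
            (if a == alpha1 then b = f alpha1
             else b = f (rho T a) \/ b = f a)
        & a * b = young a b <->
            (a = pinv D f b \/ a = sigma T (pinv D f b))]) /\
  ({in D &, {homo f : x y /~ x < y}} ->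
    forall a b, D a -> ray Tt beta1 b -> young a b <= a * b).
Proof.
move=> D Tt young; have [cT _] := T_ts; have [+ _] := image_ts; rewrite -/D -/Tt => cTt.
have Do : D alpha1 by apply/rayP.
have oD t : D t -> alpha1 <= t by move=> /rayP[].
have TD t : D t -> T t by move=> /rayP[].
split=> [incf a b Da /rayP[[c Dc <-{b}] _]|decf a b Da /rayP[[c Dc <-{b}] cb]].
  have injf : {in D &, injective f} := inc_inj_in (le_mono_in incf).
  have fK s : D s -> pinv D f (f s) = s by move=> Ds; apply: pinvKV; rewrite ?inE.
  have lef : {in D &, {homo f : x y / x <= y}} := ltW_homo_in incf.
  have [H [HP Hd]] := delta_primitive_exists cT T_alpha1 f_cont lef.
  (* The contributions of the lower limits [alpha1] and [beta1] cancel against [alpha1 * beta1]. *)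
  have youngE : young a (f c) = a * f c + (H a - H c - f c * (a - c)).
    rewrite /young (delta_int_eq cT T_alpha1 (TD _ Da) (oD _ Da) (H := H)); last first.
      by move=> t Tt_ /andP[ot _]; apply: Hd; apply/rayP.
    rewrite (nabla_int_eq cTt _ _ _ (H := fun y => y * pinv D f y - H (pinv D f y))).
    - by rewrite -f_alpha1 !fK//; lra.
    - by exists alpha1.
    - by exists c.
    - by rewrite -f_alpha1 lef ?inE ?oD.
    - move=> _ [t Dt <-] _; apply: nabla_primitive_inverse => //.
      exact: closed_ray.
  have eqE : a * f c = young a (f c) <-> a = c \/ a = sigma T c.
    rewrite -(monotone_primitive_remainder_eq0 cT incf HP Da Dc) youngE.
    by split; lra.
  split.
  - by rewrite youngE lerDl subr_ge0 (monotone_primitive_remainder_ge0 HP).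
  - rewrite eqE (eq_sigma_rho cT Da Dc).
    have Dr : a != alpha1 -> D (rho T a).
      move=> ao; apply/rayP; split; first exact: rho_mem cT (TD _ Da).
      by apply: rho_ge => //; rewrite lt_neqAle eq_sym ao oD.
    have feq x y : D x -> D y -> f x = f y <-> x = y.
      by move=> Dx Dy; split => [|->//]; apply: injf; rewrite inE.
    have [ao|ao] := eqVneq a alpha1; first by rewrite (feq _ _ Dc Do).
    by rewrite (feq _ _ Dc (Dr ao)) (feq _ _ Dc Da).
  - by rewrite fK.
have fco : f c = f alpha1.
  apply/eqP; rewrite eq_le f_alpha1 cb andbT -f_alpha1.
  have /predU1P[<-//|oc] : (alpha1 == c) || (alpha1 < c) by rewrite -le_eqVlt oD.
  by rewrite ltW// decf ?inE.
(* The construction is applied to the nondecreasing function [- f]; then [- H] is a delta primitive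
   of [f]. *)
have decf' : {in D &, {homo (-%R \o f) : x y / x <= y}}.
  move=> x y xD yD; rewrite le_eqVlt => /predU1P[->//|xy] /=.
  by rewrite lerN2 ltW// decf.
have fcN : {within D, continuous (-%R \o f)}.
  move=> x; apply: (@continuous_comp (subspace D) R R f -%R);
    [exact: f_cont|exact: opp_continuous].
have [H [HP Hd]] := delta_primitive_exists cT T_alpha1 fcN decf'.
have dE : delta_int T f alpha1 a = H alpha1 - H a.
  rewrite (delta_int_eq cT T_alpha1 (TD _ Da) (oD _ Da) (H := cst 0 \- H))/=; first by lra.
  move=> t Tt_ /andP[ot _]; rewrite -[f t]opprK -[- - f t]add0r.
  apply: jump_deriveB; last by apply: Hd; apply/rayP.
  by move=> e e0; exists 1 => // s _ _; rewrite mul0r !subrr normr0 mulr_ge0// ltW.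
have nE : nabla_int Tt (pinv D f) (f alpha1) (f alpha1) = 0.
  have oT : Tt (f alpha1) by exists alpha1.
  (* Even over a one-point interval [get] needs a primitive; the linear function of slope [k]
     serves. *)
  pose k := pinv D f (f alpha1).
  rewrite (nabla_int_eq cTt oT oT (lexx _) (H := *%R k)) ?subrr//.
  move=> t _; rewrite -eq_le => /eqP <- e e0; exists 1 => // s _ _.
  by rewrite mulrBr subrr normr0 mulr_ge0// ltW.
rewrite /young dE fco -f_alpha1 nE.
have := monotone_primitive_remainder_ge0 HP Da Do; rewrite /=; lra.
Qed.
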